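(* Assume that the inner-approximation algorithm (described in the context), run on $\Omega\subset\mathbb{R}^n$ with precision $\varepsilon>0$, terminates with a nonempty collection of boxes $\mathcal{Y}=\{Y_1,\dots,Y_N\}$ and corresponding recorded mode sets $\mathcal{C}=\{C_1,\dots,C_N\}$. Then the controller $$c(x)=\bigcup_{i=1}^{N}\psi_{Y_i}(x),\quad x\in\Omega,\qquad \psi_{Y_i}(x)=\begin{cases}\varnothing & \text{if }x\notin Y_i,\\ C_i & \text{if }x\in Y_i,\end{cases}$$ renders the closed-loop system invariant with respect to $\Omega$, i.e. $c$ is an invariance controller with respect to $\Omega$.
   Context: Switched system: $x_{k+1}=f_{p_k}(x_k)$, $k\in\mathbb{Z}_{\ge0}$, with state $x_k\in\mathbb{R}^n$, mode $p_k\in\mathcal{M}$, $\mathcal{M}$ a finite set, and each $f_p:\mathbb{R}^n\to\mathbb{R}^n$ continuous. A switching signal is an infinite sequence $\sigma=\{p_k\}_{k=0}^\infty$ in $\mathcal{M}$; given $\sigma$ and an initial state $x_0$, the resulting solution is the unique sequence $\{x_k\}_{k=0}^\infty$ satisfying the system equation. A (memoryless) switching controller is a function $c:\mathbb{R}^n\to2^{\mathcal{M}}$. A switching signal $\sigma=\{p_k\}_{k=0}^\infty$ conforms to $c$ if $p_k\in c(x_k)$ for all $k\ge0$, where $\{x_k\}_{k=0}^\infty$ is the resulting solution. A switching controller $c$ is an invariance controller with respect to $\Omega$ if, for some initial state $x_0\in\Omega$ and any switching signal $\sigma=\{p_k\}_{k=0}^\infty$ that conforms to $c$, the resulting solution $\{x_k\}_{k=0}^\infty$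 satisfies $x_k\in\Omega$ for all $k\ge0$. A box is $[x]=[\underline{x}_1,\overline{x}_1]\times\cdots\times[\underline{x}_n,\overline{x}_n]$, with width $w([x])=\max_i(\overline{x}_i-\underline{x}_i)$; $\mathbb{IR}^n$ is the set of boxes. For each $p$, $[f_p]:\mathbb{IR}^n\to\mathbb{IR}^n$ is a fixed convergent inclusion function of $f_p$: $f_p([x])\subset[f_p]([x])$ for all $[x]\in\mathbb{IR}^n$, and $\lim_{w([x])\to0}w([f_p]([x]))=0$. Procedure CPre$(Y,L,\varepsilon)$: the input is a target set $Y$, a finite list $L$ of boxes and $\varepsilon>0$. Start with $\underline{X},\Delta X,X_c,\mathcal{C}$ empty. While $L$ is nonempty, remove a box $[x]$ from $L$ and do the following. - If $[f_p]([x])\cap Y=\varnothing$ for all $p\in\mathcal{M}$, put $[x]$ in $X_c$. - Otherwise, if $[f_p]([x])\subset Y$ for some $p\in\mathcal{M}$, put $[x]$ in $\underline{X}$ and record in $\mathcal{C}$, as the entry corresponding to $[x]$, a nonempty set of modes $p$ with $[f_p]([x])\subset Y$. - Otherwise, if $w([x])<\varepsilon$, put $[x]$ in $\Delta X$. - Otherwise, bisect $[x]$ at the midpoint of a coordinate in which its width is attained, and add the two halves to $L$. The output is $(\underline{X},\Delta X,X_c,\mathcal{C})$. Inner-approximation algorithm: $\Omega$ is a compact set that is a finite union of boxes. Initialize $L$ as a finite list of boxes (with pairwise disjoint interiors) whose union is $\Omega$, $\widetilde{Y}:=\Omega$, $Y:=\varnothing$. While $Y\ne\widetilde{Y}$: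 set $Y:=\widetilde{Y}$; compute $(\underline{X},\Delta X,X_c,\mathcal{C})=$ CPre$(Y,L,\varepsilon)$; set $\widetilde{Y}:=\bigcup_{[x]\in\underline{X}}[x]$ and $L:=\underline{X}$. The output is the final list $\mathcal{Y}=\{Y_1,\dots,Y_N\}$ of boxes in $\underline{X}$ (whose union is the final $Y$) together with the mode sets $C_i$ recorded in the last call of CPre for the boxes $Y_i$; thus $f_p(Y_i)\subset\bigcup_{j=1}^N Y_j$ for every $p\in C_i$. *)

(* Defs.v *)
From HB Require Import structures.
From Stdlib Require Relations List.
From mathcomp Require Import all_boot all_order all_algebra.
From mathcomp Require Import all_classical all_reals all_analysis.

Set Implicit Arguments.
Unset Strict Implicit.
Unset Printing Implicit Defensive.

Import Order.TTheory GRing.Theory Num.Theory.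
Import numFieldNormedType.Exports.

Local Open Scope classical_set_scope.
Local Open Scope ring_scope.

Section SwitchedSystem.
Context {R : realType} {n : nat} {M : finType}.
Implicit Types (f : M -> 'rV[R]_n -> 'rV[R]_n) (sigma : nat -> M)
  (c : 'rV[R]_n -> set M) (Omega : set 'rV[R]_n).

Fixpoint solution f sigma (x0 : 'rV[R]_n) (k : nat) : 'rV[R]_n :=
  if k is k'.+1 then f (sigma k') (solution f sigma x0 k') else x0.

Definition conforms f c sigma (x0 : 'rV[R]_n) : Prop :=
  forall k, c (solution f sigma x0 k) (sigma k).

(* The initial state is quantified existentially, and the invariance is
   required of the conforming signals only; no such signal need exist. *)
Definition invariance_controller f c Omega : Prop :=
  exists2 x0, Omega x0 &
    forall sigma, conforms f c sigma x0 ->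
      forall k, Omega (solution f sigma x0 k).

End SwitchedSystem.

Section Boxes.
Context {R : realType} {n : nat}.

(* Boxes are nonempty; degenerate sides are allowed. *)
Record box := Box {
  lo : 'rV[R]_n;
  hi : 'rV[R]_n;
  lo_le_hi : forall i, lo 0 i <= hi 0 i }.

Definition box_set (b : box) : set 'rV[R]_n :=
  [set x | forall i, lo b 0 i <= x 0 i <= hi b 0 i].

(* The default value 0 is harmless, since all the sides are nonnegative; it is
   the width of the only box when n = 0. *)
Definition width (b : box) : R :=
  \big[Num.max/0]_(i < n) (hi b 0 i - lo b 0 i).

Definition boxes_union (L : seq box) : set 'rV[R]_n :=
  \big[setU/set0]_(b <- L) box_set b.

Definition disjoint_interiors (L : seq box) : Prop :=
  List.ForallOrdPairs
    (fun b b' => interior (box_set b) `&` interior (box_set b') = set0) L.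

Definition midpoint (b : box) (i : 'I_n) : R := (lo b 0 i + hi b 0 i) / 2.

Definition replace_coord (v : 'rV[R]_n) (i : 'I_n) (a : R) : 'rV[R]_n :=
  \row_j (if j == i then a else v 0 j).

Fact lower_half_subproof (b : box) (i j : 'I_n) :
  lo b 0 j <= replace_coord (hi b) i (midpoint b i) 0 j.
Proof.
rewrite mxE; case: eqP => [->|_]; last exact: lo_le_hi.
by rewrite (midf_le (lo_le_hi b i)).1.
Qed.

Fact upper_half_subproof (b : box) (i j : 'I_n) :
  replace_coord (lo b) i (midpoint b i) 0 j <= hi b 0 j.
Proof.
rewrite mxE; case: eqP => [->|_]; last exact: lo_le_hi.
by rewrite (midf_le (lo_le_hi b i)).2.
Qed.

Definition lower_half (b : box) (i : 'I_n) : box :=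
  Box (lower_half_subproof b i).

Definition upper_half (b : box) (i : 'I_n) : box :=
  Box (upper_half_subproof b i).

Definition inclusion_function (f : 'rV[R]_n -> 'rV[R]_n) (F : box -> box) :=
  forall b, f @` box_set b `<=` box_set (F b).

(* The limit is taken over all boxes, hence is uniform in their position. *)
Definition convergent (F : box -> box) : Prop :=
  forall e : R, 0 < e ->
    exists2 d : R, 0 < d & forall b, width b < d -> width (F b) < e.

End Boxes.
Arguments box R n : clear implicits.

Section Algorithm.
Context {R : realType} {n : nat} {M : finType}.
Variable F : M -> box R n -> box R n.
Implicit Types (Y Omega : set 'rV[R]_n) (eps : R) (L : seq (box R n)).

(* The boxes of the inner approximation are stored together with the mode sets
   recorded for them. *)
Record cpre_state := CPreState {
  cpre_todo : seq (box R n);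
  cpre_inner : seq (box R n * set M);
  cpre_undecided : seq (box R n);
  cpre_outer : seq (box R n) }.

Definition misses Y (b : box R n) : Prop :=
  forall p, box_set (F p b) `&` Y = set0.

Definition controllable Y (b : box R n) : Prop :=
  exists p, box_set (F p b) `<=` Y.

(* The choice of the box to treat, of the mode set to record and of the
   coordinate to bisect (among the widest ones) is nondeterministic. *)
Inductive cpre_step Y eps : cpre_state -> cpre_state -> Prop :=
| cpre_step_outer L1 b L2 X D Xc :
    misses Y b ->
    cpre_step Y eps (CPreState (L1 ++ b :: L2) X D Xc)
                    (CPreState (L1 ++ L2) X D (b :: Xc))
| cpre_step_inner L1 b L2 X D Xc (C : set M) :
    ~ misses Y b -> controllable Y b ->
    C !=set0 -> C `<=` [set p | box_set (F p b) `<=` Y] ->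
    cpre_step Y eps (CPreState (L1 ++ b :: L2) X D Xc)
                    (CPreState (L1 ++ L2) ((b, C) :: X) D Xc)
| cpre_step_undecided L1 b L2 X D Xc :
    ~ misses Y b -> ~ controllable Y b -> width b < eps ->
    cpre_step Y eps (CPreState (L1 ++ b :: L2) X D Xc)
                    (CPreState (L1 ++ L2) X (b :: D) Xc)
| cpre_step_bisect L1 b L2 X D Xc (i : 'I_n) :
    ~ misses Y b -> ~ controllable Y b -> eps <= width b ->
    hi b 0 i - lo b 0 i = width b ->
    cpre_step Y eps
      (CPreState (L1 ++ b :: L2) X D Xc)
      (CPreState (lower_half b i :: upper_half b i :: L1 ++ L2) X D Xc).

Definition cpre Y L eps (X : seq (box R n * set M)) (D Xc : seq (box R n)) :
    Prop :=
  Relation_Operators.clos_refl_trans _ (cpre_step Y eps)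
    (CPreState L [::] [::] [::]) (CPreState [::] X D Xc).

Record loop_state := LoopState {
  loop_list : seq (box R n);
  loop_next : set 'rV[R]_n;
  loop_prev : set 'rV[R]_n;
  loop_inner : seq (box R n * set M) }.

Inductive loop_step eps : loop_state -> loop_state -> Prop :=
| loop_step_body L Ynext Yprev X X' D Xc :
    Yprev <> Ynext -> cpre Ynext L eps X' D Xc ->
    loop_step eps
      (LoopState L Ynext Yprev X)
      (LoopState (map fst X') (boxes_union (map fst X')) Ynext X').

(* Started from the list of boxes L0, the algorithm may terminate with the
   boxes and mode sets listed in out. *)
Definition inner_approximation Omega eps L0 (out : seq (box R n * set M)) :
    Prop :=
  exists L Y,
    Relation_Operators.clos_refl_trans _ (loop_step eps)
      (LoopState L0 Omega set0 [::]) (LoopState L Y Y out).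

Definition psi (YC : box R n * set M) (x : 'rV[R]_n) : set M :=
  if x \in box_set YC.1 then YC.2 else set0.

End Algorithm.

(* Main.v *)
Require Import Defs.
From Stdlib Require Relations List.
From mathcomp Require Import all_boot all_order all_algebra.
From mathcomp Require Import all_classical all_reals all_analysis.

Import Order.TTheory GRing.Theory Num.Theory.
Import numFieldNormedType.Exports.

Local Open Scope classical_set_scope.
Local Open Scope ring_scope.

(** Suppose that the algorithm stops with the set [Y], the union of the output
    boxes. The last call of CPre had [Y] as its target, because the loop stops
    only when the new union of boxes equals the target just used. Hence every
    mode [p] recorded for an output box [b] satisfies [F p b `<=` Y]
    ([cpre_records]), and since [F p] is an inclusion function, [f p] maps the
    part of [Y] inside [b] into [Y]. A signal that conforms to [c] picks, at a
    state of [Y], a mode recorded for some output box containing this state,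
    so a solution that starts in [Y] never leaves [Y].

    It remains to see that [Y `<=` Omega]. CPre only discards, moves or bisects
    boxes, so the region covered by its boxes never grows
    ([cpre_inner_subset]); the loop starts from boxes covering [Omega].

    As initial state one can take any point of [Y], which is nonempty because
    the boxes are. The nonemptiness of the output also excludes the run that
    stops at once, in which no call of CPre takes place. *)

Lemma clos_refl_trans_invariant {T : Type} {r : T -> T -> Prop} (P : T -> Prop) :
  (forall s s', r s s' -> P s -> P s') ->
  forall s s', Relation_Operators.clos_refl_trans _ r s s' -> P s -> P s'.
Proof.
move=> rP s s'; elim=> {s s'} [s s' /rP|//|s1 s2 s3 _ P12 _ P23 /P12] //.
Qed.

(** Membership is [List.In] because boxes carry no [eqType] structure. *)
Lemma bigsetU_In {I T : Type} {s : seq I} {A : I -> set T} {x : T} :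
  (\big[setU/set0]_(i <- s) A i) x -> exists2 i, List.In i s & A i x.
Proof.
elim: s => [|i s IHs]; first by rewrite big_nil.
rewrite big_cons => -[Ai|/IHs[j sj Aj]]; first by exists i => //; left.
by exists j => //; right.
Qed.

Section Algorithm.
Context {R : realType} {n : nat} {M : finType}.
Variable F : M -> box R n -> box R n.
Implicit Types (Y Omega : set 'rV[R]_n) (eps : R) (L : seq (box R n))
  (X : seq (box R n * set M)) (b : box R n).

Lemma lower_half_subset b i : box_set (lower_half b i) `<=` box_set b.
Proof.
move=> x xb j; have /andP[lx xh] := xb j; rewrite lx (le_trans xh)//=.
rewrite mxE; case: eqP => [->|//].
exact: (midf_le (lo_le_hi b i)).2.
Qed.

Lemma upper_half_subset b i : box_set (upper_half b i) `<=` box_set b.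
Proof.
move=> x xb j; have /andP[lx xh] := xb j; rewrite xh andbT.
apply: le_trans lx; rewrite /= mxE; case: eqP => [->|//].
exact: (midf_le (lo_le_hi b i)).1.
Qed.

(** Boxes declared undecided or outer are lost for the rest of the algorithm,
    so they are not counted. *)
Definition cpre_region (s : @cpre_state R n M) : set 'rV[R]_n :=
  boxes_union (cpre_todo s) `|` boxes_union (map fst (cpre_inner s)).

Lemma cpre_step_region Y eps s s' :
  cpre_step F Y eps s s' -> cpre_region s' `<=` cpre_region s.
Proof.
case=> [L1 b L2 X D Xc|L1 b L2 X D Xc C|L1 b L2 X D Xc|L1 b L2 X D Xc i] _ *;
  rewrite /cpre_region /boxes_union /= ?(big_cat, big_cons) /= => x /=;
  rewrite ?(big_cat, big_cons) /=; try tauto.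
have := @lower_half_subset b i x; have := @upper_half_subset b i x; tauto.
Qed.

Lemma cpre_inner_subset Y L eps X D Xc :
  cpre F Y L eps X D Xc -> boxes_union (map fst X) `<=` boxes_union L.
Proof.
move=> /(clos_refl_trans_invariant
  (fun s => cpre_region s `<=` boxes_union L)) inv.
have {inv} : cpre_region (CPreState [::] X D Xc) `<=` boxes_union L.
  apply: inv => [s s' /cpre_step_region/subset_trans|]; first exact.
  by rewrite /cpre_region /boxes_union /= big_nil setU0.
by apply: subset_trans; exact: subsetUr.
Qed.

Definition records Y X : Prop :=
  forall YC, List.In YC X -> YC.2 `<=` [set p | box_set (F p YC.1) `<=` Y].

Lemma cpre_records Y L eps X D Xc : cpre F Y L eps X D Xc -> records Y X.
Proof.
move=> /(clos_refl_trans_invariant (fun s => records Y (cpre_inner s))) inv.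
apply: inv => [s s' [] //=|]; last by move=> YC [].
by move=> L1 b L2 X' D' Xc' C _ _ _ CY rec YC [<- //|/rec].
Qed.

(** The disjunction separates the initial state, where nothing has been
    recorded yet and [loop_prev] is a dummy value, from the later ones. *)
Definition loop_invariant Omega (s : @loop_state R n M) : Prop :=
  [/\ boxes_union (loop_list s) `<=` Omega,
      records (loop_prev s) (loop_inner s) &
      loop_inner s = [::] \/
      loop_list s = map fst (loop_inner s) /\
      loop_next s = boxes_union (loop_list s)].

Lemma loop_step_invariant Omega eps s s' :
  loop_step F eps s s' -> loop_invariant Omega s -> loop_invariant Omega s'.
Proof.
case=> L Ynext Yprev X X' D Xc _ pre [/= LOmega _ _]; split => /=.
- exact: subset_trans (cpre_inner_subset _ _ _ _ _ _ pre) LOmega.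
- exact: cpre_records pre.
- by right.
Qed.

Lemma inner_approximationP Omega eps L0 X :
  boxes_union L0 = Omega -> inner_approximation F Omega eps L0 X ->
  X <> [::] ->
  boxes_union (map fst X) `<=` Omega /\ records (boxes_union (map fst X)) X.
Proof.
move=> L0Omega [L [Y /(clos_refl_trans_invariant (loop_invariant Omega)) inv]].
move=> X0; have [] : loop_invariant Omega (LoopState L Y Y X).
  apply: inv => [s s'|]; first exact: loop_step_invariant.
  by split => //=; [rewrite L0Omega|left].
by move=> /= LOmega recX [//|[LX YL]]; rewrite -LX; split => //; rewrite -YL.
Qed.

End Algorithm.

Lemma bigsetU_psi {R : realType} {n : nat} {M : finType}
    (X : seq (box R n * set M)) (x : 'rV[R]_n) (p : M) :
  (\big[setU/set0]_(YC <- X) psi YC x) p ->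
  exists2 YC, List.In YC X & box_set YC.1 x /\ YC.2 p.
Proof.
move=> /(bigsetU_In (A := psi ^~ x))[YC XYC]; rewrite /psi; case: ifPn => // /set_mem xY Cp.
by exists YC.
Qed.

Lemma solution_invariant {R : realType} {n : nat} {M : finType}
    (f : M -> 'rV[R]_n -> 'rV[R]_n) (c : 'rV[R]_n -> set M)
    (Y : set 'rV[R]_n) (sigma : nat -> M) (x0 : 'rV[R]_n) :
  (forall x p, Y x -> c x p -> Y (f p x)) ->
  Y x0 -> conforms f c sigma x0 -> forall k, Y (solution f sigma x0 k).
Proof.
by move=> fY Yx0 cs; elim=> [//|k IHk] /=; apply: fY => //; exact: cs.
Qed.

Theorem proposition8 (R : realType) (n : nat) (M : finType)
    (f : M -> 'rV[R]_n -> 'rV[R]_n)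
    (f_continuous : forall p, continuous (f p))
    (F : M -> box R n -> box R n)
    (F_inclusion : forall p, inclusion_function (f p) (F p))
    (F_convergent : forall p, convergent (F p))
    (Omega : set 'rV[R]_n) (Omega_compact : compact Omega)
    (eps : R) (eps_gt0 : 0 < eps)
    (L0 : seq (box R n))
    (L0_union : boxes_union L0 = Omega)
    (L0_disjoint : disjoint_interiors L0)
    (out : seq (box R n * set M))
    (out_computed : inner_approximation F Omega eps L0 out)
    (out_nonempty : out <> [::])
    (c : 'rV[R]_n -> set M)
    (c_def : forall x, Omega x -> c x = \big[setU/set0]_(YC <- out) psi YC x) :
  invariance_controller f c Omega.
Proof.
have [YOmega recY] := inner_approximationP F _ _ _ _ L0_union out_computed
  out_nonempty.
set Y := boxes_union (map fst out) in YOmega recY.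
have [x0 Yx0] : Y !=set0.
  rewrite /Y; case: (out) out_nonempty => // YC X _.
  exists (lo YC.1); rewrite /boxes_union /= big_cons; left => i.
  by rewrite lexx lo_le_hi.
exists x0 => [|sigma cs k]; first exact: YOmega.
apply: (YOmega); apply: (solution_invariant _ _ _ _ _ _ Yx0 cs) => x p Yx.
rewrite c_def; last exact: YOmega.
move=> /bigsetU_psi[YC outYC [xYC Cp]].
by apply: (recY _ outYC _ Cp); apply: F_inclusion; exists x.
Qed.
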